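(* Let $p\in(0,1)$ and, for each $n$, let $a_{n,p}=q_p\left(M_{-1}(U_1,\dots,U_n)\right)$, where $U_1,\dots,U_n$ are independent and uniformly distributed on $(0,1)$. Then $$a_{n,p}\sim\left(\frac{\pi}{2}S_1^{-1}(1-p)+\log\left(\frac{n\pi}{2}\right)+1-\gamma\right)^{-1}\to 0\quad\text{as } n\to\infty,$$ where $\gamma$ is the Euler--Mascheroni constant.
   Context: $M_{-1}$ is the symmetric harmonic mean: $M_{-1}(u_1,\dots,u_n)=\left(\frac1n\sum_{i=1}^n u_i^{-1}\right)^{-1}$ for $(u_1,\dots,u_n)\in(0,\infty)^n$. For $\alpha\in(0,1]$ and a random variable $X$, $q_\alpha(X)=\inf\{x\in\mathbb R:\mathbb P(X\le x)\ge\alpha\}$ is the left $\alpha$-quantile, also written $F^{-1}(\alpha)$ if $X$ has distribution function $F$. $S_1$ is the (stable) distribution function on $\mathbb R$ with characteristic function $\int_{\mathbb R}\exp(i\theta x)\,\mathrm dS_1(x)=\exp\left(-|\theta|\left(1+i\frac{2}{\pi}\mathrm{sgn}(\theta)\log|\theta|\right)\right)$, $\theta\in\mathbb R$, where $\mathrm{sgn}$ is the sign function. The notation $x_n\sim y_n$ as $n\to\infty$ means $x_n/y_n\to1$. *)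

(* Defs.v *)
From HB Require Import structures.
From mathcomp Require Import all_boot all_order all_algebra.
From mathcomp Require Import all_classical all_reals all_analysis.
From mathcomp Require Export complex.

Set Implicit Arguments.
Unset Strict Implicit.
Unset Printing Implicit Defensive.

Import Order.TTheory GRing.Theory Num.Theory.
Import numFieldNormedType.Exports.

Local Open Scope classical_set_scope.
Local Open Scope ring_scope.
Local Open Scope complex_scope.

Section Definitions.
Context {R : realType}.

(* Only meaningful for positive entries: since 0^-1 = 0 here, a null entry
   contributes nothing to the sum. *)
Definition hmean n (u : 'I_n -> R) : R :=
  (n%:R^-1 * \sum_(i < n) (u i)^-1)^-1.

(* [inf] is total on [set R]; the set below is nonempty and bounded from below
   when F is a distribution function and 0 < a < 1. *)
Definition geninv (F : R -> R) (a : R) : R := inf [set x | a <= F x].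

Definition quantile d (T : measurableType d) (P : probability T R)
    (a : R) (X : T -> R) : R :=
  inf [set x | (a%:E <= P [set w | (X w <= x)%R])%E].

Definition mutually_independent d (T : measurableType d) (P : probability T R)
    (I : finType) (X : I -> {RV P >-> R}) : Prop :=
  forall (J : {set I}) (A : I -> set R), (forall i, measurable (A i)) ->
    P (\bigcap_(i in [set i | i \in J]) (X i @^-1` A i)) =
    (\prod_(i in J) P (X i @^-1` A i))%E.

(* [uniform_prob] puts mass on the closed interval, but the endpoints are
   null. *)
Definition uniform01 d (T : measurableType d) (P : probability T R)
    (X : {RV P >-> R}) : Prop :=
  forall A : set R, measurable A ->
    distribution P X A = uniform_prob (@ltr01 R) A.

Definition cexp (z : R[i]) : R[i] :=
  (expR (complex.Re z))%:C
  * (cos (complex.Im z) +i* sin (complex.Im z)).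

Definition Cintegral d (T : measurableType d) (mu : {measure set T -> \bar R})
    (f : T -> R[i]) : R[i] :=
  (\int[mu]_x complex.Re (f x)) +i* (\int[mu]_x complex.Im (f x)).

Definition charfun (F : cumulativeBounded (0 : R) (1 : R)) (t : R) : R[i] :=
  Cintegral (lebesgue_stieltjes_measure F)
    (fun x => cexp ('i%C * t%:C * x%:C)).

(* At t = 0 the junk value of [ln 0] is multiplied by 0. *)
Definition is_S1 (F : cumulativeBounded (0 : R) (1 : R)) : Prop :=
  forall t : R,
    charfun F t =
    cexp (- (`|t|%:C * (1 + 'i%C * (2 / pi)%:C * (Num.sg t)%:C * (ln `|t|)%:C))).

Definition asymp_equiv (x y : R^nat) : Prop := x n / y n @[n --> \oo] --> (1 : R).

End Definitions.

Definition euler_mascheroni (R : realType) : R :=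
  limn (fun n => (\sum_(1 <= k < n.+1) k%:R^-1) - ln n%:R : R).

(* Main.v *)
From HB Require Import structures.
Require Import Defs.
From mathcomp Require Import all_boot all_order all_algebra.
From mathcomp Require Import all_classical all_reals all_analysis.
From mathcomp Require Import measurable_realfun.
From mathcomp Require Import ring lra.

Set Implicit Arguments.
Unset Strict Implicit.
Unset Printing Implicit Defensive.

Import Order.TTheory GRing.Theory Num.Theory.
Import numFieldNormedType.Exports.

Local Open Scope classical_set_scope.
Local Open Scope ring_scope.

(** The denominator of the equivalent is [ln n] plus a constant, and the ratio
    of two sequences of the form [ln n + O(1)] tends to 1 ([cvg_shift_ratio]).
    So it suffices that [(a n)^-1 = ln n + O(1)], and for this it suffices that
    the reciprocal [n^-1 * \sum_i (U i)^-1] of the harmonic mean, recentred by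
    [ln n], is tight: a level [p] strictly between 0 and 1 cannot be crossed
    outside an interval that carries enough mass ([quantile_concentration]).

    The variables [(U i)^-1] have infinite mean, so tightness
    ([reciprocal_mean_tight]) comes from truncation. Fix [0 < eta < 1] and put
    [delta = eta / n]. All the [U i] lie in [[delta, 1]] except on an event of
    probability at most [n * delta = eta], and there [(U i)^-1] equals its
    truncation. The truncated reciprocal has mean [- ln delta = ln n - ln eta]
    and second moment [delta^-1 - 1], and independence makes the variances add
    up, so that the average of the truncations has variance at most
    [(n * delta)^-1 = eta^-1]. By Chebyshev's inequality it deviates from its
    mean by [eta^-1] or more with probability at most [eta]. Altogether the
    recentred mean stays within a constant [eta^-1] of [- ln eta] outside an
    event of probability at most [2 * eta], uniformly in [n]; any [eta] with
    [2 * eta < p] and [2 * eta <= 1 - p] then gives the bounds on [a n]. *)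

(** * Measures and measurability *)

Lemma measurable_invr (R : realType) : measurable_fun setT (@GRing.inv R).
Proof.
have -> : [set: R] = [set 0] `|` [set~ 0] by rewrite setUv.
apply/measurable_funU => //; first exact: measurableC.
split; first exact: measurable_fun_set1.
apply: open_continuous_measurable_fun.
  by apply: closed_openC; exact: closed_eq.
by move=> x; rewrite inE => /eqP; exact: inv_continuous.
Qed.

Lemma measure_bigsetU_le d (T : measurableType d) (R : realType)
    (mu : {measure set T -> \bar R}) (I : Type) (s : seq I) (F : I -> set T) :
  (forall i, measurable (F i)) ->
  (mu (\big[setU/set0]_(i <- s) F i) <= \sum_(i <- s) mu (F i))%E.
Proof.
move=> mF; elim: s => [|i s IH]; first by rewrite !big_nil measure0.
rewrite !big_cons; apply: le_trans; last exact: (leeD (lexx _) IH).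
by apply: measureU2 => //; exact: bigsetU_measurable.
Qed.

Lemma measurable_norm_ge d (T : measurableType d) (R : realType)
    (f : T -> R) (c : R) :
  measurable_fun setT f -> measurable [set w | c <= `|f w|].
Proof.
move=> mf.
rewrite (_ : [set _ | _] = setT `&` (fun w => `|f w|) @^-1` `[c, +oo[).
  exact: (measurableT_comp (@normr_measurable _ setT) mf).
by rewrite setTI; apply/seteqP; split=> w /=; rewrite in_itv/= andbT.
Qed.

(** * Independence and variances *)

Lemma bounded_Lfun2 d (T : measurableType d) (R : realType)
    (P : probability T R) (f : T -> R) (M : R) :
  measurable_fun setT f -> (forall x, `|f x| <= M) -> f \in Lfun P 2%:E.
Proof.
move=> mf fM; rewrite inE; apply/andP; split; rewrite inE//=.
rewrite /finite_norm unlock /Lnorm poweR_lty//.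
apply: (@le_lt_trans _ _ (\int[P]_x (M `^ 2)%:E)%E); last first.
  by rewrite integral_cst// ltey_eq fin_numM// fin_num_measure.
apply: ge0_le_integral => //.
- by move=> x _; rewrite lee_fin powR_ge0.
- apply/measurable_EFinP.
  apply: (@measurableT_comp _ _ _ _ _ _ (@powR R ^~ 2)) => //.
  exact: measurableT_comp.
- by move=> x _; rewrite lee_fin ge0_ler_powR// nnegrE// (le_trans _ (fM x)).
Qed.

Lemma variance_sum_uncorrelated d (T : measurableType d) (R : realType)
    (P : probability T R) (I : finType) (X : I -> T -> R) :
  (forall i, X i \in Lfun P 2%:E) ->
  (forall i j, i != j -> covariance P (X i) (X j) = 0%E) ->
  'V_P[\sum_i X i] = (\sum_i 'V_P[X i])%E.
Proof.
move=> X2 X0; have := index_enum_uniq I.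
elim: (index_enum I) => [_|i s IH /= /andP[si us]].
  by rewrite !big_nil variance_cst.
have S2 : \sum_(j <- s) X j \in Lfun P 2%:E.
  by rewrite rpred_sum ?lee1n.
rewrite !big_cons.
have -> : X i + \sum_(j <- s) X j = (X i \+ \sum_(j <- s) X j)%R by [].
rewrite varianceD// (IH us).
suff -> : covariance P (X i) (\sum_(j <- s) X j)%R = 0%E.
  by rewrite mule0 adde0.
elim: s si {us IH S2} => [_|j s IH]; first by rewrite big_nil covariance_cst_r.
rewrite inE negb_or => /andP[ij si].
rewrite big_cons.
have -> : X j + \sum_(k <- s) X k = (X j \+ \sum_(k <- s) X k)%R by [].
rewrite covarianceDr// ?X0// ?IH// ?adde0//.
by rewrite rpred_sum ?lee1n.
Qed.

(** The product rule on rectangles says that the joint law of [X] and [Y] agrees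
    with the product of their laws on a generating class, hence everywhere; the
    factorisation is then Tonelli's theorem. *)
Lemma ge0_integral_mul_independent d (T : measurableType d) (R : realType)
    (P : probability T R) (X Y : {RV P >-> R}) (f g : R -> R) :
  (forall A B, measurable A -> measurable B ->
    P (X @^-1` A `&` Y @^-1` B) = (P (X @^-1` A) * P (Y @^-1` B))%E) ->
  measurable_fun setT f -> measurable_fun setT g ->
  (forall x, 0 <= f x) -> (forall x, 0 <= g x) ->
  (\int[P]_w (f (X w) * g (Y w))%:E =
   \int[P]_w (f (X w))%:E * \int[P]_w (g (Y w))%:E)%E.
Proof.
move=> ind mf mg f0 g0.
have mXY : measurable_fun setT (fun w => (X w, Y w)).
  exact: measurable_fun_pair.
pose XY : {mfun T >-> (R * R)%type} :=
  HB.pack (fun w => (X w, Y w)) (isMeasurableFun.Build _ _ _ _ _ mXY).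
pose h (z : R * R) := (f z.1 * g z.2)%:E.
have mh : measurable_fun setT h.
  apply/measurable_EFinP; apply: measurable_funM => //=.
    by apply: measurableT_comp.
  by apply: measurableT_comp.
have h0 z : (0 <= h z)%E by rewrite lee_fin mulr_ge0.
transitivity (\int[distribution P XY]_z h z)%E.
  by rewrite ge0_integral_distribution.
transitivity (\int[(distribution P X \x distribution P Y)%E]_z h z)%E.
  apply: eq_measure_integral => /= A mA _.
  apply/esym.
  by apply: product_measure_unique => //= B C mB mC; rewrite -ind.
rewrite fubini_tonelli1//= /fubini_F /h /=.
under eq_integral => x _.
  under eq_integral do rewrite EFinM.
  rewrite ge0_integralZl//=; last 3 first.
  - exact/measurable_EFinP.
  - by move=> y _; rewrite lee_fin.
  - by rewrite lee_fin.
  over.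
rewrite /= ge0_integralZr//=; last 3 first.
- exact/measurable_EFinP.
- by move=> y _; rewrite lee_fin.
- by apply: integral_ge0 => y _; rewrite lee_fin.
by rewrite !ge0_integral_distribution//=; try exact/measurable_EFinP;
  move=> y; rewrite lee_fin.
Qed.

Lemma mutually_independent_pair d (T : measurableType d) (R : realType)
    (P : probability T R) (I : finType) (U : I -> {RV P >-> R}) (i j : I)
    (A B : set R) :
  mutually_independent U -> i != j -> measurable A -> measurable B ->
  P (U i @^-1` A `&` U j @^-1` B) = (P (U i @^-1` A) * P (U j @^-1` B))%E.
Proof.
move=> hind ij mA mB.
pose C k := if k == i then A else B.
have mC k : measurable (C k) by rewrite /C; case: ifP.
have ji : (j == i) = false by rewrite eq_sym (negbTE ij).
have := hind [set i; j]%SET C mC.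
rewrite big_setU1/= ?inE// big_set1 /C eqxx ji => <-.
congr (P _); apply/seteqP; split=> w /=.
  move=> [Ai Bj] k /=; rewrite !inE => /orP[] /eqP ->.
    by rewrite eqxx.
  by rewrite ji.
move=> AB; split.
  by have := AB i; rewrite /= !inE eqxx; apply.
by have := AB j; rewrite /= !inE eqxx orbT ji; apply.
Qed.

(** * Moments of the truncated reciprocal of a uniform variable *)

Lemma uniform01_integral d (T : measurableType d) (R : realType)
    (P : probability T R) (X : {RV P >-> R}) (f : R -> R) :
  uniform01 X -> measurable_fun setT f -> (forall x, 0 <= f x) ->
  (\int[P]_w (f (X w))%:E =
   \int[lebesgue_measure]_(x in `[0%R, 1%R]) (f x)%:E)%E.
Proof.
move=> unifX mf f0.
(* [uniform_prob] is a measure on the generated sigma-algebra of the real line,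
   so [X] is first retyped to take its values there. *)
have mX : measurable_fun setT (X : T -> measurableTypeR R).
  exact: (@measurable_funPT _ _ _ _ X).
pose X' : {mfun T >-> measurableTypeR R} :=
  HB.pack (X : T -> measurableTypeR R) (isMeasurableFun.Build _ _ _ _ _ mX).
have mf' : measurable_fun setT (EFin \o f : measurableTypeR R -> \bar R).
  by apply/measurable_EFinP.
transitivity (\int[distribution P X']_x (f x)%:E)%E.
  by rewrite ge0_integral_distribution// => x; rewrite lee_fin.
transitivity (\int[uniform_prob (@ltr01 R)]_x (f x)%:E)%E.
  by apply: eq_measure_integral => A mA _; exact: unifX.
by rewrite integral_uniform ?subr0 ?invr1 ?mul1e.
Qed.

Definition trunc_inv (R : realType) (delta x : R) : R :=
  \1_`[delta, 1] x * x^-1.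

Section truncated_inverse.
Context {R : realType} (delta : R).
Hypothesis delta01 : 0 < delta < 1.

Let delta0 : 0 < delta. Proof. by case/andP: delta01. Qed.

Lemma measurable_trunc_inv : measurable_fun setT (trunc_inv delta).
Proof.
apply: measurable_funM; last exact: measurable_invr.
exact: measurable_indic.
Qed.

Lemma trunc_invE x : delta <= x <= 1 -> trunc_inv delta x = x^-1.
Proof.
by move=> x1; rewrite /trunc_inv indicE mem_set ?mul1r//= in_itv.
Qed.

Lemma trunc_inv_ge0 x : 0 <= trunc_inv delta x.
Proof.
rewrite /trunc_inv indicE; have [|_] := boolP (_ \in _); last by rewrite mul0r.
rewrite inE/= in_itv/= => /andP[dx _].
by rewrite mul1r invr_ge0 (le_trans _ dx)// ltW.
Qed.

Lemma trunc_inv_le x : trunc_inv delta x <= delta^-1.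
Proof.
rewrite /trunc_inv indicE; have [|_] := boolP (_ \in _); last first.
  by rewrite mul0r invr_ge0 ltW.
rewrite inE/= in_itv/= => /andP[dx _].
by rewrite mul1r lef_pV2// posrE (lt_le_trans delta0).
Qed.

Let integral_trunc (g : R -> R) :
  (\int[lebesgue_measure]_(x in `[0%R, 1%R]) (\1_`[delta, 1%R] x * g x)%:E =
   \int[lebesgue_measure]_(x in `[delta, 1%R]) (g x)%:E)%E.
Proof.
have sub : `[delta, 1] `<=` `[0, 1].
  by apply: subset_itvr; rewrite bnd_simp ltW.
rewrite -[in RHS](setIidr sub) integral_mkcondr.
apply: eq_integral => x _; rewrite patchE indicE.
by case: ifPn; rewrite (mul1r, mul0r).
Qed.

Let within_continuous (f : R -> R) :
  (forall x : R, 0 < x -> {for x, continuous f}) ->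
  {within `[delta, 1], continuous f}.
Proof.
move=> cf; apply: continuous_in_subspaceT => x.
rewrite inE/= in_itv/= => /andP[dx _].
by apply: cf; rewrite (lt_le_trans delta0).
Qed.

(** Both moments below are integrals over [[delta, 1]] of a function with a
    known primitive on the positive half-line. *)
Let FTC2 (f F : R -> R) :
  (forall x : R, 0 < x -> {for x, continuous f}) ->
  (forall x : R, 0 < x -> is_derive x 1 F (f x)) ->
  (\int[lebesgue_measure]_(x in `[delta, 1%R]) (f x)%:E =
   (F 1%R)%:E - (F delta)%:E)%E.
Proof.
move=> cf dF.
have d1 : delta < 1 by case/andP: delta01.
have F_cont x : 0 < x -> {for x, continuous F}.
  move=> /dF dFx; apply: differentiable_continuous.
  by apply/derivable1_diffP; apply: ex_derive.
apply: continuous_FTC2 => //.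
- exact: within_continuous.
- split.
  + move=> x; rewrite in_itv/= => /andP[dx _].
    by have ? := dF _ (lt_trans delta0 dx); exact: ex_derive.
  + by apply: cvg_at_right_filter; exact: F_cont.
  + by apply: cvg_at_left_filter; exact: F_cont.
- move=> x; rewrite in_itv/= => /andP[dx _].
  by have ? := dF _ (lt_trans delta0 dx); rewrite derive1E derive_val.
Qed.

Lemma integral_trunc_inv :
  (\int[lebesgue_measure]_(x in `[0%R, 1%R]) (trunc_inv delta x)%:E =
   (- ln delta)%:E)%E.
Proof.
rewrite integral_trunc (FTC2 (F := @ln R)).
- by rewrite ln1 add0e.
- by move=> x x0; apply: inv_continuous; rewrite gt_eqF.
Qed.

Lemma integral_trunc_inv_sqr :
  (\int[lebesgue_measure]_(x in `[0%R, 1%R]) (trunc_inv delta x ^+ 2)%:E =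
   (delta^-1 - 1)%:E)%E.
Proof.
under eq_integral => x _.
  rewrite /trunc_inv exprMn -[X in X * _]/(\1_`[delta, 1] x ^+ 2).
  have -> : (\1_`[delta, 1] x : R) ^+ 2 = \1_`[delta, 1] x.
    by rewrite indicE; case: (_ \in _); rewrite ?expr1n ?expr0n.
  over.
have dF (x : R) : 0 < x -> is_derive x 1 (fun y => - y^-1) (x^-1 ^+ 2).
  move=> x0; have xn0 : x != 0 by rewrite gt_eqF.
  have dV : is_derive x 1 (fun y : R => y^-1) (- x ^- 2 *: 1).
    exact: (is_deriveV (f := id)).
  rewrite (_ : x^-1 ^+ 2 = - (- x ^- 2 *: 1)); first exact: is_deriveN.
  by rewrite scaleNr opprK exprVn; apply/esym; exact: mulr1.
rewrite integral_trunc (FTC2 _ dF).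
  by rewrite invr1 -EFinN -EFinD opprK addrC.
move=> x x0.
rewrite -[X in {for _, continuous X}]/((fun z => z ^+ 2) \o GRing.inv).
apply: continuous_comp; last exact: exprn_continuous.
by apply: inv_continuous; rewrite gt_eqF.
Qed.

End truncated_inverse.

Lemma uniform01_outside d (T : measurableType d) (R : realType)
    (P : probability T R) (X : {RV P >-> R}) (delta : R) :
  uniform01 X -> 0 < delta < 1 ->
  (P (X @^-1` (~` `[delta, 1%R])) <= delta%:E)%E.
Proof.
move=> unifX /andP[d0 d1].
have mA : measurable (~` `[delta, 1] : set R) by exact: measurableC.
have := unifX _ mA; rewrite /distribution /pushforward => ->.
rewrite /uniform_prob integral_uniform_pdf.
rewrite [X in (\int[_]_(x in X) _)%E](_ : _ = `[0, delta[%classic).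
  rewrite (eq_integral (cst 1%E)).
    rewrite integral_cst//= mul1e lebesgue_measure_itv/= lte_fin d0.
    by rewrite oppr0 adde0.
  move=> x; rewrite inE/= in_itv/= => /andP[x0 xd].
  by rewrite /uniform_pdf x0 (le_trans (ltW xd) (ltW d1)) subr0 invr1.
apply/seteqP; split=> x /=; rewrite !in_itv/=.
  move=> [xn /andP[-> x1]]/=; rewrite ltNge; apply/negP => dx.
  by apply: xn; rewrite dx x1.
move=> /andP[x0 xd]; split; first by rewrite leNgt xd.
by rewrite x0 (le_trans (ltW xd) (ltW d1)).
Qed.

(** * Tightness of the recentred reciprocal mean *)

Section reciprocal_mean_tight.
Context d (T : measurableType d) (R : realType) (P : probability T R).
Context (n : nat) (U : 'I_n -> {RV P >-> R}).
Hypothesis n_gt0 : (0 < n)%N.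
Hypothesis hind : mutually_independent U.
Hypothesis hunif : forall i, uniform01 (U i).
Context (eta : R).
Hypothesis eta01 : 0 < eta < 1.

Let delta : R := eta / n%:R.

Let n0 : 0 < n%:R :> R. Proof. by rewrite ltr0n. Qed.

Let eta0 : 0 < eta. Proof. by case/andP: eta01. Qed.

Let delta0 : 0 < delta. Proof. exact: divr_gt0. Qed.

Let delta01 : 0 < delta < 1.
Proof.
rewrite delta0 ltr_pdivrMr// mul1r.
case/andP: eta01 => _ /lt_le_trans; apply.
by rewrite ler1n.
Qed.

Let Y i w := trunc_inv delta (U i w).

Let mY i : measurable_fun setT (Y i).
Proof. by apply: measurableT_comp => //; exact: measurable_trunc_inv. Qed.

Let Y2 i : Y i \in Lfun P 2%:E.
Proof.
apply: (@bounded_Lfun2 _ _ _ _ _ delta^-1) => // w.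
rewrite ger0_norm; first exact: trunc_inv_le.
exact: trunc_inv_ge0.
Qed.

Let Y1 i : Y i \in Lfun P 1.
Proof. by apply: Lfun_subset12; rewrite ?fin_num_measure. Qed.

Let expectation_Y i : ('E_P[Y i] = (- ln delta)%:E)%E.
Proof.
rewrite unlock uniform01_integral ?integral_trunc_inv//.
  exact: measurable_trunc_inv.
by move=> x; exact: trunc_inv_ge0.
Qed.

(** The bound drops the squared mean: the second moment [delta^-1 - 1] already
    has the right order. *)
Let variance_Y i : ('V_P[Y i] <= delta^-1%:E)%E.
Proof.
rewrite varianceE// expectation_Y.
apply: (@le_trans _ _ ('E_P[(Y i ^+ 2)%R])%E).
  by rewrite leeBlDr// leeDl// -EFin_expe lee_fin sqr_ge0.
rewrite unlock.
rewrite (uniform01_integral (f := fun x => trunc_inv delta x ^+ 2))//.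
- by rewrite integral_trunc_inv_sqr// lee_fin gerBl.
- by apply: measurable_funX; exact: measurable_trunc_inv.
- by move=> x; exact: sqr_ge0.
Qed.

Let covariance_Y i j : i != j -> covariance P (Y i) (Y j) = 0%E.
Proof.
move=> ij; rewrite covarianceE//; last exact: Lfun2_mul_Lfun1.
suff -> : ('E_P[(Y i * Y j)%R] = 'E_P[Y i] * 'E_P[Y j])%E.
  by rewrite !expectation_Y -EFinM subee.
rewrite unlock (ge0_integral_mul_independent (X := U i) (Y := U j)) //.
- by move=> A B; exact: mutually_independent_pair hind ij.
- exact: measurable_trunc_inv.
- exact: measurable_trunc_inv.
- by move=> x; exact: trunc_inv_ge0.
- by move=> x; exact: trunc_inv_ge0.
Qed.

Let S : T -> R := \sum_i Y i.

Let SE w : S w = \sum_i Y i w.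
Proof. by rewrite /S fct_sumE. Qed.

Let expectation_S : ('E_P[S] = (n%:R * - ln delta)%:E)%E.
Proof.
have -> : S = \sum_(Z <- [seq Y i | i <- index_enum 'I_n]) Z.
  by rewrite big_map.
rewrite expectation_sum; last by move=> _ /mapP[i _ ->].
rewrite big_map (eq_bigr (fun=> (- ln delta)%:E))//.
by rewrite sumEFin sumr_const card_ord mulr_natl.
Qed.

Let variance_S : ('V_P[S] <= (n%:R / delta)%:E)%E.
Proof.
rewrite variance_sum_uncorrelated//.
apply: (@le_trans _ _ (\sum_(i < n) delta^-1%:E)%E).
  by apply: lee_sum => i _; exact: variance_Y.
by rewrite sumEFin sumr_const card_ord mulr_natl.
Qed.

Let mS : measurable_fun setT S.
Proof.
rewrite (_ : S = fun w => \sum_i Y i w); last by apply/funext => w; rewrite SE.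
exact: measurable_sum.
Qed.

Let far : set T := [set w | n%:R / eta <= `|S w - n%:R * - ln delta|].

Let P_far : (P far <= eta%:E)%E.
Proof.
pose S' : {mfun T >-> R} := HB.pack S (isMeasurableFun.Build _ _ _ _ _ mS).
have := @chebyshev _ _ _ P S' (n%:R / eta) (divr_gt0 n0 eta0).
rewrite expectation_S => /le_trans; apply.
apply: (@le_trans _ _ ((n%:R / eta) ^- 2 * (n%:R / delta))%:E).
  rewrite EFinM lee_pmul2l// ?variance_S//.
  by rewrite lte_fin invr_gt0 exprn_gt0// divr_gt0.
rewrite lee_fin /delta le_eqVlt; apply/orP; left; apply/eqP.
by field; rewrite !gt_eqF.
Qed.

Let outside : set T := \big[setU/set0]_(i < n) (U i @^-1` (~` `[delta, 1])).

Let moutside_i i : measurable (U i @^-1` (~` `[delta, 1])).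
Proof.
rewrite -[X in measurable X]setTI.
by apply: (@measurable_funPT _ _ _ _ (U i)) => //; exact: measurableC.
Qed.

Let P_outside : (P outside <= eta%:E)%E.
Proof.
apply: (@le_trans _ _ (\sum_(i < n) P (U i @^-1` (~` `[delta, 1%R])))%E).
  exact: measure_bigsetU_le.
apply: (@le_trans _ _ (\sum_(i < n) delta%:E)%E).
  by apply: lee_sum => i _; exact: uniform01_outside.
rewrite sumEFin sumr_const card_ord lee_fin -mulr_natl /delta mulrCA divff.
  by rewrite mulr1.
by rewrite gt_eqF.
Qed.

Let mU_sum : measurable_fun setT (fun w => \sum_(i < n) (U i w)^-1).
Proof.
apply: measurable_sum => i.
by apply: measurableT_comp => //; exact: measurable_invr.
Qed.

Lemma measurable_hmean : measurable_fun setT (fun w => hmean (fun i => U i w)).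
Proof.
apply: measurableT_comp; first exact: measurable_invr.
exact: measurable_funM.
Qed.

Definition reciprocal_mean_far : set T :=
  [set w | eta^-1 <=
    `|n%:R^-1 * (\sum_(i < n) (U i w)^-1) - (ln n%:R - ln eta)|].

Lemma measurable_reciprocal_mean_far : measurable reciprocal_mean_far.
Proof.
apply: measurable_norm_ge; apply: measurable_funB => //.
exact: measurable_funM.
Qed.

(** The bound depends on [eta] only: the choice [delta = eta / n] balances the
    probability [n * delta] of leaving the truncation window against the
    Chebyshev bound, both being equal to [eta]. *)
Lemma reciprocal_mean_tight : (P reciprocal_mean_far <= (2 * eta)%:E)%E.
Proof.
have mfar : measurable far.
  by apply: measurable_norm_ge; exact: measurable_funB.
have mout : measurable outside by apply: bigsetU_measurable.
have lnd : - ln delta = ln n%:R - ln eta.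
  by rewrite /delta ln_div ?posrE// opprB.
apply: (@le_trans _ _ (P (far `|` outside))).
  apply: le_measure; rewrite ?inE//.
  - exact: measurable_reciprocal_mean_far.
  - exact: measurableU.
  - move=> w farw; have [outw|noutw] := pselect (outside w); [by right|left].
    have SV : S w = \sum_(i < n) (U i w)^-1.
      rewrite SE; apply: eq_bigr => i _; apply: trunc_invE.
      apply: contrapT => Ui; apply: noutw.
      rewrite /outside -bigcup_seq; exists i => /=; first exact: mem_index_enum.
      by rewrite in_itv.
    rewrite /far /= SV lnd.
    set m := ln n%:R - ln eta; set s := \sum_(i < n) _.
    have -> : s - n%:R * m = n%:R * (n%:R^-1 * s - m).
      by rewrite [RHS]mulrBr mulVKf// gt_eqF.
    by rewrite normrM gtr0_norm// ler_pM2l.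
apply: le_trans; first exact: measureU2.
by rewrite mulr2n mulrDl mul1r EFinD leeD.
Qed.

End reciprocal_mean_tight.

(** * Quantiles and asymptotics *)

(** Below [lo] the distribution function of [X] is at most [P B < p], and at
    [hi] it is at least [1 - P B >= p], so that the level [p] is reached in
    between. *)
Lemma quantile_concentration d (T : measurableType d) (R : realType)
    (P : probability T R) (p lo hi : R) (X : T -> R) (B : set T) :
  measurable_fun setT X -> measurable B ->
  (P B < p%:E)%E -> (P B <= (1 - p)%:E)%E ->
  (forall w, ~ B w -> lo < X w <= hi) ->
  lo <= quantile P p X <= hi.
Proof.
move=> mX mB Bp B1p Xlohi.
have mle x : measurable [set w | X w <= x].
  rewrite -[X in measurable X]setTI -[X in _ `&` X]/(X @^-1` `]-oo, x]).
  exact: mX.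
have hi_in : [set x | (p%:E <= P [set w | (X w <= x)%R])%E] hi.
  rewrite /=; apply: (@le_trans _ _ (P (~` B))).
    rewrite probability_setC// leeBrDr ?fin_num_measure// addeC.
    by rewrite -leeBrDr// -EFinB.
  apply: le_measure; rewrite ?inE//; first exact: measurableC.
  by move=> w /Xlohi /andP[].
have lo_lb : lbound [set x | (p%:E <= P [set w | (X w <= x)%R])%E] lo.
  move=> x /= px; rewrite leNgt; apply/negP => xlo.
  have : (P [set w | (X w <= x)%R] <= P B)%E.
    apply: le_measure; rewrite ?inE// => w /= Xx.
    apply: contrapT => /Xlohi /andP[lX _].
    by move: (lt_le_trans (lt_trans xlo lX) Xx); rewrite ltxx.
  by move=> /(le_trans px)/le_lt_trans/(_ Bp); rewrite ltxx.
apply/andP; split.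
  by apply: lb_le_inf => //; exists hi.
by apply: ge_inf => //; exists lo.
Qed.

Lemma cvgry_addr (R : realType) (L : R^nat) (A : R) :
  L n @[n --> \oo] --> +oo -> L n + A @[n --> \oo] --> +oo.
Proof.
move=> Loo; apply/cvgryPge => M; near=> n; rewrite -lerBlDr.
by near: n; exact: cvgry_ge.
Unshelve. all: by end_near. Qed.

(** Wherever [L n + A] is nonzero, the ratio is [1 + (B - A) / (L n + A)]. *)
Lemma cvg_shift_ratio (R : realType) (L : R^nat) (A B : R) :
  L n @[n --> \oo] --> +oo ->
  (L n + A)^-1 / (L n + B)^-1 @[n --> \oo] --> (1 : R).
Proof.
move=> Loo.
have LAoo := cvgry_addr A Loo.
have inv0 : (L n + A)^-1 @[n --> \oo] --> 0.
  have pos : \forall n \near \oo, 0 < L n + A by exact: cvgry_gt.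
  exact/(gtr0_cvgV0 pos).
have : 1 + (B - A) * (L n + A)^-1 @[n --> \oo] --> 1 + (B - A) * 0.
  by apply: cvgD; [exact: cvg_cst|apply: cvgM; [exact: cvg_cst|]].
rewrite mulr0 addr0; apply: cvg_trans.
apply: near_eq_cvg; near=> n.
have n0 : L n + A != 0.
  by rewrite gt_eqF//; near: n; exact: cvgry_gt.
by rewrite invrK; field.
Unshelve. all: by end_near. Qed.

(** The harmonic mean is the inverse of a quantity that tightness confines to an
    interval around [ln n - ln eta]; inverting the two bounds requires the
    interval to be positive, which holds for all large [n]. *)
Lemma quantile_hmean_bounds d (T : measurableType d) (R : realType)
    (P : probability T R) (n : nat) (U : 'I_n -> {RV P >-> R}) (p eta : R) :
  (0 < n)%N -> mutually_independent U -> (forall i, uniform01 (U i)) ->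
  0 < eta -> 2 * eta < p -> 2 * eta <= 1 - p ->
  0 < ln n%:R - ln eta - eta^-1 ->
  (ln n%:R - ln eta + eta^-1)^-1 <=
    quantile P p (fun w => hmean (fun i => U i w)) <=
  (ln n%:R - ln eta - eta^-1)^-1.
Proof.
move=> n0 hind hunif eta0 etap eta1p m0.
have eta01 : 0 < eta < 1 by apply/andP; split=> //; lra.
have tight := reciprocal_mean_tight n0 hind hunif eta01.
apply: (quantile_concentration (B := reciprocal_mean_far U eta)).
- exact: measurable_hmean.
- exact: measurable_reciprocal_mean_far.
- by rewrite (le_lt_trans tight)// lte_fin.
- by rewrite (le_trans tight)// lee_fin.
move=> w /negP; rewrite -ltNge ltr_distl => /andP[].
rewrite /hmean; move: (_ * _) => s /= ms sm.
have s0 : 0 < s by exact: lt_trans m0 ms.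
by rewrite ltf_pV2 ?posrE// ?sm/= ?lef_pV2 ?posrE// ?(ltW ms)// (lt_trans s0).
Qed.

Lemma cvgy_ln_nat (R : realType) : ln (n%:R : R) @[n --> \oo] --> +oo.
Proof.
apply/cvgryPge => M; near=> n.
have Mn : expR M <= n%:R by near: n; exact: nbhs_infty_ger.
by rewrite -[M]expRK ler_ln ?posrE ?expR_gt0// (lt_le_trans _ Mn) ?expR_gt0.
Unshelve. all: by end_near. Qed.

Theorem proposition6 (R : realType) (S1 : cumulativeBounded (0 : R) (1 : R))
  (hS1 : is_S1 S1)
  (p : R) (hp : 0 < p < 1)
  (d : nat -> measure_display) (T : forall n : nat, measurableType (d n))
  (P : forall n : nat, probability (T n) R)
  (U : forall n : nat, 'I_n -> {RV (P n) >-> R})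
  (hind : forall n : nat, mutually_independent (U n))
  (hunif : forall (n : nat) (i : 'I_n), uniform01 (U n i))
  (a : R^nat)
  (ha : forall n : nat,
     a n = quantile (P n) p (fun w => hmean (fun i => U n i w))) :
  let b : R^nat := fun n =>
    (pi / 2 * geninv S1 (1 - p) + ln (n%:R * pi / 2) + 1
     - euler_mascheroni R)^-1 in
  asymp_equiv a b /\ b n @[n --> \oo] --> (0 : R).
Proof.
move=> b.
have [p0 p1] := andP hp.
pose L n : R := ln n%:R.
pose c : R := pi / 2 * geninv S1 (1 - p) + ln (pi / 2) + 1 - euler_mascheroni R.
have bE : {near \oo, b =1 fun n => (L n + c)^-1}.
  near=> n; rewrite /b -(mulrA n%:R) lnM ?posrE ?divr_gt0 ?pi_gt0 ?ltr0n//.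
    by congr (_^-1); rewrite /c /L; ring.
  by near: n; exact: nbhs_infty_gt.
have Loo : L n @[n --> \oo] --> +oo := @cvgy_ln_nat R.
have Lpos A : \forall n \near \oo, 0 < L n + A.
  by near=> n; rewrite -ltrBlDr; near: n; exact: cvgry_gt.
split; last first.
  have : (L n + c)^-1 @[n --> \oo] --> 0.
    exact/(gtr0_cvgV0 (Lpos c))/cvgry_addr.
  apply: cvg_trans; apply: near_eq_cvg; near=> n.
  by apply/esym; near: n; exact: bE.
(* A divisor greater than 2 makes [2 * eta] smaller than both [p] and
   [1 - p]. *)
pose eta : R := Num.min p (1 - p) / 3.
have eta0 : 0 < eta by rewrite divr_gt0// lt_min p0 subr_gt0.
have [etap' eta1p'] : eta * 3 <= p /\ eta * 3 <= 1 - p.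
  by rewrite /eta divfK// !ge_min !lexx orbT.
have etap : 2 * eta < p by lra.
have eta1p : 2 * eta <= 1 - p by lra.
apply: (squeeze_cvgr
  (f := fun n => (L n + (- ln eta + eta^-1))^-1 / (L n + c)^-1)
  (h := fun n => (L n + (- ln eta - eta^-1))^-1 / (L n + c)^-1)).
- near=> n.
  have n0 : (0 < n)%N by near: n; exact: nbhs_infty_gt.
  have m0 : 0 < ln n%:R - ln eta - eta^-1.
    by rewrite -addrA; near: n; exact: Lpos.
  have c0 : 0 <= ((L n + c)^-1)^-1 by rewrite invrK ltW//; near: n; exact: Lpos.
  have -> : b n = (L n + c)^-1 by near: n; exact: bE.
  have := quantile_hmean_bounds n0 (hind n) (hunif n) eta0 etap eta1p m0.
  rewrite -ha -!(addrA (ln n%:R)) => /andP[lo hi].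
  by apply/andP; split; exact: ler_wpM2r.
- exact: cvg_shift_ratio.
- exact: cvg_shift_ratio.
Unshelve. all: by end_near. Qed.
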